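(* Let $G$ be a finite simple connected graph with at least one edge and minimal vertex covers $W_1,\dots,W_m$, and let $s\ge 0$. Then the $s$-order principal component of $G$ equals $$\mathcal{V}(\langle\mathcal{J}_s(W_1)\rangle)\cup\cdots\cup\mathcal{V}(\langle\mathcal{J}_s(W_m)\rangle)\subseteq\mathbb{A}^{n(s+1)}_k.$$
   Context: $k$ is an algebraically closed field, $R=k[x_1,\dots,x_n]$ with the vertices of $G$ identified with the variables, $I(G)=\langle x_ix_j : \{x_i,x_j\}\in E(G)\rangle$ the edge ideal, and $X=\mathcal{V}(I(G))\subseteq\mathbb{A}^n_k$. $\mathcal{J}_s(R)=k[x_i^{(l)} : 1\le i\le n,\ 0\le l\le s]$, the coordinate ring of $\mathbb{A}^{n(s+1)}_k$. For $I=\langle f_1,\dots,f_r\rangle$, write $f_m(x_1^{(0)}+x_1^{(1)}t+\cdots+x_1^{(s)}t^s,\dots)\equiv\sum_{l=0}^s\alpha_m^{(l)}t^l\pmod{t^{s+1}}$ and set $\mathcal{J}_s(I)=\langle\alpha_m^{(l)}\rangle$; the jet scheme is $\mathcal{J}_s(X)=\mathcal{V}(\mathcal{J}_s(I(G)))\subseteq\mathbb{A}^{n(s+1)}_k$. The projection $\pi_s:\mathcal{J}_s(X)\to X$ sends a point to its coordinates $(x_1^{(0)},\dots,x_n^{(0)})$; for an open $U\subseteq X$, $\mathcal{J}_s(U)=\pi_s^{-1}(U)$. Let $X_{smooth}$ be the set of smooth points of $X$. The $s$-order principal component of $G$ is the Zariski closure of $\mathcal{J}_s(X_{smooth})$ in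 $\mathbb{A}^{n(s+1)}_k$. For $W\subseteq V(G)$, $\mathcal{J}_s(W)=\{x^{(j)} : x\in W,\ 0\le j\le s\}$. A minimal vertex cover is an inclusion-minimal set of vertices meeting every edge. *)

(* Defs.v *)
From HB Require Import structures.
From mathcomp Require Import all_boot all_order all_algebra.
From mathcomp Require Import mpoly.
Set Implicit Arguments. Unset Strict Implicit. Unset Printing Implicit Defensive.
Import Order.TTheory GRing.Theory.
Local Open Scope ring_scope.

Definition zero_locus (k : fieldType) (N : nat) (T : {mpoly k[N]} -> Prop)
  : ('I_N -> k) -> Prop := fun x => forall p, T p -> p.@[x] = 0.

Definition vanishing_ideal (k : fieldType) (N : nat) (S : ('I_N -> k) -> Prop)
  : {mpoly k[N]} -> Prop := fun p => forall x, S x -> p.@[x] = 0.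

Definition zariski_closed (k : fieldType) (N : nat) (S : ('I_N -> k) -> Prop) :=
  exists T : {mpoly k[N]} -> Prop, forall x, S x <-> zero_locus T x.

Definition zariski_closure (k : fieldType) (N : nat) (S : ('I_N -> k) -> Prop) :=
  zero_locus (vanishing_ideal S).

Definition irreducible_closed (k : fieldType) (N : nat) (S : ('I_N -> k) -> Prop) :=
  [/\ zariski_closed S, (exists x, S x) &
      forall S1 S2 : ('I_N -> k) -> Prop, zariski_closed S1 -> zariski_closed S2 ->
        (forall x, S x -> S1 x \/ S2 x) ->
        (forall x, S x -> S1 x) \/ (forall x, S x -> S2 x)].

Definition irr_chain_through (k : fieldType) (N : nat) (X : ('I_N -> k) -> Prop)
  (p : 'I_N -> k) (d : nat) :=
  exists Z : nat -> ('I_N -> k) -> Prop,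
    (forall i, (i <= d)%N ->
       [/\ irreducible_closed (Z i), Z i p & forall x, Z i x -> X x]) /\
    (forall i, (i < d)%N ->
       (forall x, Z i x -> Z i.+1 x) /\ exists x, Z i.+1 x /\ ~ Z i x).

Definition local_dim (k : fieldType) (N : nat) (X : ('I_N -> k) -> Prop)
  (p : 'I_N -> k) (d : nat) :=
  irr_chain_through X p d /\ ~ irr_chain_through X p d.+1.

Definition tangent_space (k : fieldType) (N : nat) (X : ('I_N -> k) -> Prop)
  (p : 'I_N -> k) : 'rV[k]_N -> Prop :=
  fun v => forall f, vanishing_ideal X f ->
    \sum_(i < N) (mderiv i f).@[p] * v 0 i = 0.

Definition tangent_dim (k : fieldType) (N : nat) (X : ('I_N -> k) -> Prop)
  (p : 'I_N -> k) (d : nat) :=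
  (exists vs : seq 'rV[k]_N,
      [/\ size vs = d, free vs & forall v, v \in vs -> tangent_space X p v]) /\
  (forall vs : seq 'rV[k]_N,
      free vs -> (forall v, v \in vs -> tangent_space X p v) -> (size vs <= d)%N).

Definition smooth_point (k : fieldType) (N : nat) (X : ('I_N -> k) -> Prop)
  (p : 'I_N -> k) :=
  X p /\ exists d, local_dim X p d /\ tangent_dim X p d.

Definition simple_graph (n : nat) (e : rel 'I_n) :=
  (forall i j, e i j = e j i) /\ (forall i, ~~ e i i).

Definition connected_graph (n : nat) (e : rel 'I_n) :=
  forall i j, connect e i j.

Definition edge_gens (k : fieldType) (n : nat) (e : rel 'I_n) : {mpoly k[n]} -> Prop :=
  fun f => exists i j, e i j /\ f = 'X_i * 'X_j.

Definition vertex_cover (n : nat) (e : rel 'I_n) (W : {set 'I_n}) :=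
  forall i j, e i j -> i \in W \/ j \in W.

Definition minimal_vertex_cover (n : nat) (e : rel 'I_n) (W : {set 'I_n}) :=
  vertex_cover e W /\
  forall W' : {set 'I_n}, vertex_cover e W' -> W' \subset W -> W' = W.

(* A point of A^{n(s+1)} is a matrix A with A i l = x_i^{(l)}. *)
Definition arc (k : fieldType) (n s : nat) (A : 'M[k]_(n, s.+1)) (i : 'I_n) : {poly k} :=
  \sum_(l < s.+1) A i l *: 'X^l.

(* V(J_s(I)) for I generated by T: all coefficients alpha_f^{(l)}, l <= s, of
   f(x^(0) + x^(1) t + ... + x^(s) t^s) vanish *)
Definition jet_scheme (k : fieldType) (n s : nat) (T : {mpoly k[n]} -> Prop)
  : 'M[k]_(n, s.+1) -> Prop :=
  fun A => forall f, T f -> forall l : nat, (l <= s)%N ->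
    (mmap (@polyC k) (arc A) f)`_l = 0.

Definition jet_proj (k : fieldType) (n s : nat) (A : 'M[k]_(n, s.+1)) : 'I_n -> k :=
  fun i => A i ord0.

Definition jet_coords (k : fieldType) (n s : nat) (A : 'M[k]_(n, s.+1))
  : 'I_(n * s.+1) -> k := fun t => mxvec A 0 t.

(* J_s(X_smooth) = pi_s^{-1}(X_smooth) *)
Definition jets_over_smooth (k : fieldType) (n s : nat) (T : {mpoly k[n]} -> Prop)
  : 'M[k]_(n, s.+1) -> Prop :=
  fun A => jet_scheme T A /\ smooth_point (zero_locus T) (jet_proj A).

Definition principal_component (k : fieldType) (n s : nat) (e : rel 'I_n)
  : 'M[k]_(n, s.+1) -> Prop :=
  fun A => zariski_closure
             (fun y => exists B : 'M[k]_(n, s.+1), jets_over_smooth (@edge_gens k n e) B /\ y = jet_coords B)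
             (jet_coords A).

Definition jet_cover_locus (k : fieldType) (n s : nat) (W : {set 'I_n})
  : 'M[k]_(n, s.+1) -> Prop :=
  fun A => forall i, i \in W -> forall l : 'I_s.+1, A i l = 0.

(* Main.v *)
Require Import Defs.
From HB Require Import structures.
From mathcomp Require Import all_boot all_order all_algebra.
From mathcomp Require Import boolp.
From mathcomp Require Import mpoly.
(* Imported again because [path.arc] shadows [Defs.arc]. *)
Require Import Defs.
Set Implicit Arguments. Unset Strict Implicit. Unset Printing Implicit Defensive.
Import Order.TTheory GRing.Theory.
Local Open Scope ring_scope.

(* At a point p of X, let F be the set of vertices having a neighbour in the
   support of p.  The tangent space of X at p is the coordinate subspace
   {v : v_i = 0 for i in F}, of dimension n - |F|.  An irreducible closed subset
   of X through p lies in {x : x_i = 0 for i in V} for some vertex cover V avoiding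
   the support of p, so its dimension is at most n - |V|, and F is contained in
   every such V.  Hence at a smooth point F = V is a minimal vertex cover; every
   vertex of F then has a neighbour whose arc is a unit modulo t^(s+1), which
   forces the arcs of F to vanish.  Conversely, the points whose support is the
   complement of a minimal vertex cover W are smooth, and the jets above them are
   dense in the linear space V(J_s(W)).

   For the bound on dimensions: given a chain Z_0 < ... < Z_m of irreducible closed
   sets, choose f_i vanishing on Z_i but not on Z_(i+1).  Then f_0, ..., f_(m-1) are
   algebraically independent on Z_m, whereas more than d polynomials in d variables
   are algebraically dependent. *)

(** * Restriction to lines: irreducibility and directional derivatives *)

Definition line (k : nzRingType) (N : nat) (x y : 'I_N -> k) (t : k) : 'I_N -> k :=
  fun i => x i + t * (y i - x i).

Definition line_restrict (k : comNzRingType) (N : nat) (x y : 'I_N -> k)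
  (f : {mpoly k[N]}) : {poly k} :=
  mmap (@polyC k) (fun i => (x i)%:P + (y i - x i) *: 'X) f.

Lemma line_restrictE (k : comNzRingType) N (x y : 'I_N -> k) f t :
  (line_restrict x y f).[t] = f.@[line x y t].
Proof.
rewrite /line_restrict mevalE /mmap horner_sum; apply: eq_bigr => m _.
rewrite hornerM hornerC; congr (_ * _); rewrite /mmap1 horner_prod.
by apply: eq_bigr => i _; rewrite horner_exp !hornerE mulrC.
Qed.

(** On the line, [f] and [g] become univariate polynomials, nonzero because of their values at
    [t = 0] and [t = 1]. Their product has a non-root, as an algebraically closed field is
    infinite. *)
Lemma line_nonzero (k : closedFieldType) N (x y : 'I_N -> k) (f g : {mpoly k[N]}) :
  f.@[x] != 0 -> g.@[y] != 0 ->
  exists t, f.@[line x y t] != 0 /\ g.@[line x y t] != 0.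
Proof.
move=> fx gy.
have Rf : line_restrict x y f != 0.
  apply: contraNneq fx => R0; have := line_restrictE x y f 0.
  rewrite R0 horner0 => ->; apply/eqP/meval_eq => i.
  by rewrite /line mul0r addr0.
have Rg : line_restrict x y g != 0.
  apply: contraNneq gy => R0; have := line_restrictE x y g 1.
  rewrite R0 horner0 => ->; apply/eqP/meval_eq => i.
  by rewrite /line mul1r addrC subrK.
have /closed_nonrootP [t] : line_restrict x y f * line_restrict x y g != 0.
  by rewrite mulf_neq0.
rewrite rootE hornerM mulf_eq0 negb_or !line_restrictE => /andP tfg.
by exists t.
Qed.

(** The zero loci of [f] and [g] are closed and together cover [Z], so one of them contains it. *)
Lemma irreducible_closed_prime (k : fieldType) N (Z : ('I_N -> k) -> Prop) f g :
  irreducible_closed Z -> vanishing_ideal Z (f * g) ->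
  vanishing_ideal Z f \/ vanishing_ideal Z g.
Proof.
move=> [_ _ irrZ] fg0.
have cl (h : {mpoly k[N]}) : zariski_closed (fun x => h.@[x] = 0).
  exists (eq h) => x; split => [hx p <- //|]; exact.
apply: (irrZ _ _ (cl f) (cl g)) => x /fg0 /eqP.
by rewrite mevalM mulf_eq0 => /orP [] /eqP; [left|right].
Qed.

(** If [Z] had a point [x] outside [S1] and a point [y] outside [S2], the line joining them would
    carry a point of [Z] outside both. *)
Lemma line_stable_irreducible (k : closedFieldType) N (Z : ('I_N -> k) -> Prop) :
  zariski_closed Z -> (exists x, Z x) ->
  (forall x y t, Z x -> Z y -> Z (line x y t)) -> irreducible_closed Z.
Proof.
move=> clZ neZ lineZ; split=> // S1 S2 [T1 S1E] [T2 S2E] ZS.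
case: (pselect (forall x, Z x -> S1 x)) => [|/existsNP [x /not_implyP [Zx S1x]]].
  by left.
right => y Zy; apply: contrapT => S2y.
have [f T1f /eqP fx] : exists2 f, T1 f & f.@[x] <> 0.
  apply: contrapT => nf; apply: S1x; apply/S1E => p T1p.
  by apply: contrapT => px; apply: nf; exists p.
have [g T2g /eqP gy] : exists2 g, T2 g & g.@[y] <> 0.
  apply: contrapT => nf; apply: S2y; apply/S2E => p T1p.
  by apply: contrapT => px; apply: nf; exists p.
have [t [ft gt]] := line_nonzero fx gy.
have [/S1E /(_ f T1f) e|/S2E /(_ g T2g) e] := ZS _ (lineZ _ _ t Zx Zy).
  by rewrite e eqxx in ft.
by rewrite e eqxx in gt.
Qed.

(** Chain rule: the identity passes to products and linear combinations, so it is enough to check it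
    on the variables. *)
Lemma deriv_mmap_polyC (k : comNzRingType) N (h : 'I_N -> {poly k}) (f : {mpoly k[N]}) :
  (mmap (@polyC k) h f)^`() =
  \sum_(i < N) mmap (@polyC k) h (mderiv i f) * (h i)^`().
Proof.
pose D p := (mmap (@polyC k) h p)^`() =
  \sum_(i < N) mmap (@polyC k) h (mderiv i p) * (h i)^`().
have DM p q : D p -> D q -> D (p * q).
  rewrite /D rmorphM derivM => -> ->; rewrite mulr_suml mulr_sumr -big_split.
  apply: eq_bigr => i _; rewrite mderivM rmorphD !rmorphM /= mulrDl; congr (_ + _).
    by rewrite mulrAC.
  by rewrite mulrA.
have D1 : D 1.
  rewrite /D rmorph1 derivC big1 // => i _.
  by rewrite -mpolyC1 mderivC rmorph0 mul0r.
have DX m : D 'X_[m].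
  rewrite mpolyXE_id; apply: big_ind => // i _.
  elim: (m i) => [|e IH]; rewrite ?expr0 ?exprS //; apply: DM => //.
  rewrite /D mmapX mmap1U (bigD1 i) //= big1 => [|j ji].
    rewrite mderivX mnm1E eqxx scale1r mmapX addr0.
    have -> : (U_(i) - U_(i))%MM = 0%MM :> 'X_{1..N}.
      by apply/mnmP => j; rewrite mnmBE mnm0E subnn.
    by rewrite mmap11 mul1r.
  by rewrite mderivX mnm1E eq_sym (negbTE ji) scale0r rmorph0 mul0r.
elim/mpolyind: f => [|c m p _ _ IH].
  by rewrite rmorph0 deriv0 big1 // => i _; rewrite mderiv0 rmorph0 mul0r.
rewrite rmorphD derivD IH /= mmapZ mul_polyC derivZ (DX m) scaler_sumr -big_split.
apply: eq_bigr => i _ /=.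
by rewrite mderivD mderivZ rmorphD /= mmapZ mul_polyC scalerAl mulrDl.
Qed.

(** Since [k] is infinite, the restriction of [f] to the line is the zero polynomial; the chain rule
    evaluates its derivative at 0. *)
Lemma directional_derivative_eq0 (k : closedFieldType) N (f : {mpoly k[N]})
    (p v : 'I_N -> k) :
  (forall t, f.@[fun i => p i + t * v i] = 0) ->
  \sum_(i < N) (mderiv i f).@[p] * v i = 0.
Proof.
move=> f0; pose y i := p i + v i.
have lineE t : line p y t =1 (fun i => p i + t * v i).
  by move=> i; rewrite /line /y [p i + v i]addrC addrK.
have R0 : line_restrict p y f = 0.
  apply/eqP; apply: contraT => /closed_nonrootP [t].
  by rewrite rootE line_restrictE (meval_eq _ (lineE t)) f0 eqxx.
have := congr1 (horner^~ 0) (congr1 (@deriv k) R0).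
rewrite /line_restrict deriv_mmap_polyC deriv0 horner0 horner_sum => e.
rewrite -[RHS]e; apply: eq_bigr => i _; rewrite hornerM; congr (_ * _).
  have := line_restrictE p y (mderiv i f) 0; rewrite /line_restrict => ->.
  by apply: meval_eq => j; rewrite lineE mul0r addr0.
by rewrite !derivE !hornerE /y [p i + v i]addrC addrK.
Qed.

(** * Separating the last variable, and algebraic dependence by counting monomials *)

Lemma mcoeff_muni (R : comNzRingType) m (p : {mpoly R[m.+1]}) (a : 'X_{1..m.+1}) :
  (muni p)`_(a ord_max)@_[multinom a (widen_ord (leqnSn m) i) | i < m] = p@_a.
Proof.
rewrite muniE coef_sum raddf_sum /= [in RHS](mpolyE p) raddf_sum /=.
apply: eq_bigr => b _.
rewrite coefZ coefXn mcoeffZ mcoeffX; case: eqP => [ab|ab]; last first.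
  rewrite mulr0 mcoeff0; case: eqP => [ba|]; last by rewrite mulr0.
  by case: ab; rewrite ba.
rewrite mulr1 mcoeffZ mcoeffX; congr (_ * _%:R).
congr nat_of_bool; apply/eqP/eqP => [ab'|->//]; apply/mnmP => i.
have [j ->|->//] := unliftP ord_max i.
have := congr1 (fun u : 'X_{1..m} => u j) ab'; rewrite !mnmE.
suff -> : lift ord_max j = widen_ord (leqnSn m) j by [].
by apply: val_inj; rewrite /= /bump leqNgt ltn_ord.
Qed.

Lemma muni_eq0 (R : comNzRingType) m (p : {mpoly R[m.+1]}) : muni p = 0 -> p = 0.
Proof.
by move=> p0; apply/mpolyP => a; rewrite -mcoeff_muni p0 coef0 !mcoeff0.
Qed.

(** Isolates the last substituted polynomial [f m], for the induction on the length of a chain. *)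
Lemma muni_comp_mpoly (R : comNzRingType) m N (p : {mpoly R[m.+1]})
    (f : nat -> {mpoly R[N]}) :
  p \mPo [tuple f i | i < m.+1] =
  (map_poly (comp_mpoly [tuple f i | i < m]) (muni p)).[f m].
Proof.
rewrite muniE raddf_sum /= horner_sum comp_mpolyEX; apply: eq_bigr => a _.
rewrite map_polyZ /= map_polyXn hornerZ hornerXn comp_mpolyZ -scalerAl.
congr (_ *: _); rewrite !comp_mpolyX big_ord_recr /= tnth_mktuple; congr (_ * _).
by apply: eq_bigr => i _; rewrite !tnth_mktuple mnmE.
Qed.

Lemma mnm_le_mdeg m (a : 'X_{1..m}) i : (a i <= mdeg a)%N.
Proof. by rewrite mdegE (bigD1 i) //= leq_addr. Qed.

Lemma leq_expn a b m : (a <= b)%N -> (a ^ m <= b ^ m)%N.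
Proof. by case: m => // m ab; rewrite leq_exp2r. Qed.

(** Every exponent of a monomial of degree below [b] is itself below [b]. *)
Lemma bmultinom_card m b : (#|{: 'X_{1..m < b}}| <= b ^ m)%N.
Proof.
pose g (a : 'X_{1..m < b}) : {ffun 'I_m -> 'I_b} :=
  [ffun i => Ordinal (leq_ltn_trans (mnm_le_mdeg a i) (bmdeg a))].
have g_inj : injective g.
  move=> a a' /ffunP ga; apply: val_inj; apply/mnmP => i.
  by have /(congr1 val) := ga i; rewrite !ffunE.
by have := leq_card g g_inj; rewrite card_ffun !card_ord.
Qed.

Lemma msize_exp_le (R : idomainType) m (p : {mpoly R[m]}) c a :
  (msize p <= c)%N -> (msize (p ^+ a) <= a * c + 1)%N.
Proof.
move=> pc; elim: a => [|a IH]; first by rewrite expr0 msize1.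
rewrite exprS; have [->|p0] := eqVneq p 0; first by rewrite mul0r msize0.
rewrite msizeM ?expf_neq0 // mulSn -addnA.
by apply: leq_trans (leq_pred _) _; apply: leq_add.
Qed.

Lemma msize_prod_le (R : idomainType) m r (F : 'I_r -> {mpoly R[m]}) c :
  (forall i, msize (F i) <= c)%N -> (msize (\prod_(i < r) F i) <= r * c + 1)%N.
Proof.
elim: r F => [|r IH] F Fc; first by rewrite big_ord0 msize1.
rewrite big_ord_recl; set G := \prod_(_ < r) _.
have Gc : (msize G <= r * c + 1)%N by apply: IH.
have [->|p0] := eqVneq (F ord0) 0; first by rewrite mul0r msize0.
have [->|G0] := eqVneq G 0; first by rewrite mulr0 msize0.
rewrite msizeM // mulSn -addnA.
by apply: leq_trans (leq_pred _) _; apply: leq_add.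
Qed.

Lemma mpoly_algebraic_dependence (F : fieldType) m d (f : m.-tuple {mpoly F[d]}) :
  (d < m)%N -> exists2 Q : {mpoly F[m]}, Q != 0 & Q \mPo f = 0.
Proof.
move=> dm.
pose c := \max_(i < m) msize (tnth f i).
have fc i : (msize (tnth f i) <= c)%N.
  by apply: (leq_bigmax (F := fun i => msize (tnth f i))).
(* There are (D + 1)^m monomials in the f_i with exponents at most D, and they all
   lie in the span of the at most K^d <= (C (D + 1))^d monomials of degree < K;
   D = C^d makes the former number larger. *)
pose C := (m * (c + 1) + 1)%N.
pose D := (C ^ d)%N.
pose K := (m * (D * c + 1) + 1)%N.
have KC : (K <= C * D.+1)%N.
  rewrite /K /C mulnDl mul1n -mulnA leq_add // leq_mul // mulnDl mul1n.
  by rewrite mulnS [(c * D)%N]mulnC leq_add // leq_addl.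
have KD : (K ^ d < D.+1 ^ m)%N.
  apply: (@leq_ltn_trans ((C * D.+1) ^ d)); first exact: leq_expn.
  rewrite expnMn; apply: (@leq_trans (D.+1 ^ d.+1)); last by rewrite leq_pexp2l.
  by rewrite expnS ltn_pmul2r // expn_gt0.
pose E : finType := {ffun 'I_m -> 'I_D.+1}; pose B : finType := 'X_{1..d < K}.
pose mon (a : E) : 'X_{1..m} := [multinom (a i : nat) | i < m].
have mon_inj : injective mon.
  move=> a b ab; apply/ffunP => i; apply: val_inj.
  by have := congr1 (fun u : 'X_{1..m} => u i) ab; rewrite !mnmE.
pose P (a : E) := 'X_[mon a] \mPo f.
have Psize a : (msize (P a) <= K)%N.
  rewrite /P comp_mpolyX; apply: msize_prod_le => i; rewrite mnmE.
  apply: leq_trans (msize_exp_le _ (fc i)) _.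
  by rewrite leq_add2r leq_mul // -ltnS ltn_ord.
(* Row [a] lists the coefficients of [P a]. There are more rows than columns, so a nonzero vector of
   the left kernel exists; its entries are the coefficients of [Q]. *)
pose M : 'M[F]_(#|E|, #|B|) :=
  \matrix_(i, j) (P (enum_val i))@_(enum_val j : 'X_{1..d < K}).
have /negP kerM : ~ row_free M.
  move=> /eqP rM; have := rank_leq_col M; rewrite rM leqNgt => /negP; apply.
  apply: leq_ltn_trans (bmultinom_card d K) _.
  by rewrite card_ffun !card_ord.
rewrite -kermx_eq0 in kerM.
pose u := nz_row (kermx M).
have u0 : u != 0 by rewrite nz_row_eq0.
have uM : u *m M = 0 by apply/sub_kermxP/nz_row_sub.
exists (\sum_(i < #|E|) u 0 i *: 'X_[mon (enum_val i)]).
  apply: contraNneq u0 => Q0; apply/eqP/rowP => i; rewrite mxE.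
  have := congr1 (fun q => q@_(mon (enum_val i))) Q0.
  rewrite /= mcoeff0 => <-; rewrite raddf_sum (bigD1 i) //= big1 => [|j ji].
    by rewrite mcoeffZ mcoeffX eqxx mulr1 addr0.
  rewrite mcoeffZ mcoeffX (inj_eq mon_inj) (inj_eq enum_val_inj) (negbTE ji).
  by rewrite mulr0.
rewrite raddf_sum /=.
under eq_bigr => i _.
  rewrite comp_mpolyZ -/(P _) (mpolywE (Psize _)) scaler_sumr; over.
rewrite exchange_big big1 //= => b _; under eq_bigr do rewrite scalerA.
rewrite -scaler_suml; have := congr1 (fun v : 'rV_#|B| => v 0 (enum_rank b)) uM.
rewrite !mxE; under eq_bigr do rewrite mxE enum_rankK.
by move=> ->; rewrite scale0r.
Qed.

(** * Bounding the length of chains of irreducible closed sets *)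

(** Induction on [m], reading [Q] as a polynomial in the last variable. On [Z m] the polynomial
    [f m] vanishes, so the induction hypothesis kills the constant coefficient. On [Z m.+1] it is a
    nonzero element of an integral domain, so a factor [f m] can be cancelled and the degree
    drops. *)
Lemma chain_algebraically_independent (k : fieldType) N
    (Z : nat -> ('I_N -> k) -> Prop) (f : nat -> {mpoly k[N]}) m :
  (forall i, (i <= m)%N -> irreducible_closed (Z i)) ->
  (forall i, (i < m)%N -> forall x, Z i x -> Z i.+1 x) ->
  (forall i, (i < m)%N ->
     vanishing_ideal (Z i) (f i) /\ ~ vanishing_ideal (Z i.+1) (f i)) ->
  forall Q : {mpoly k[m]},
    vanishing_ideal (Z m) (Q \mPo [tuple f i | i < m]) -> Q = 0.
Proof.
elim: m => [|m IH] irrZ subZ fZ Q QZ.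
  have QE : Q = (Q@_0)%:MP.
    apply/mpolyP => a; have -> : a = 0%MM by apply/mnmP => -[].
    by rewrite mcoeffC eqxx mulr1.
  have [_ [x Zx] _] := irrZ 0%N isT.
  by have := QZ x Zx; rewrite QE comp_mpolyC mevalC => ->.
have {}IH := IH (fun i im => irrZ i (leqW im)) (fun i im => subZ i (leqW im))
  (fun i im => fZ i (leqW im)).
have [fm fm'] := fZ m (leqnn _).
apply: muni_eq0; rewrite muni_comp_mpoly in QZ.
elim/poly_ind: (muni Q) QZ => // q c IHq qZ.
have evalE : (map_poly (comp_mpoly [tuple f i | i < m]) (q * 'X + c%:P)).[f m] =
    (map_poly (comp_mpoly [tuple f i | i < m]) q).[f m] * f m
      + (c \mPo [tuple f i | i < m]).
  by rewrite rmorphD rmorphM /= map_polyX map_polyC !hornerE.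
have c0 : c = 0.
  apply: IH => x Zx; have := qZ x (subZ m (leqnn _) x Zx).
  by rewrite evalE mevalD mevalM (fm x Zx) mulr0 add0r.
rewrite c0 addr0 IHq ?mul0r // => x Zx.
have := qZ; rewrite evalE c0 comp_mpoly0 addr0.
by case/(irreducible_closed_prime (irrZ m.+1 (leqnn _))) => // /(_ x Zx).
Qed.

Definition coord_subspace (k : fieldType) n (W : {set 'I_n}) : ('I_n -> k) -> Prop :=
  fun x => forall i, i \in W -> x i = 0.

Lemma coord_subspace_chain_length (k : fieldType) N
    (Z : nat -> ('I_N -> k) -> Prop) (W : {set 'I_N}) m :
  (forall i, (i <= m)%N -> irreducible_closed (Z i)) ->
  (forall i, (i < m)%N ->
     (forall x, Z i x -> Z i.+1 x) /\ exists x, Z i.+1 x /\ ~ Z i x) ->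
  (forall x, Z m x -> coord_subspace W x) -> (m <= #|~: W|)%N.
Proof.
move=> irrZ stepZ ZW; rewrite leqNgt; apply/negP => dm.
have /choice [f fP] : forall i, exists g : {mpoly k[N]}, (i < m)%N ->
    vanishing_ideal (Z i) g /\ ~ vanishing_ideal (Z i.+1) g.
  move=> i; case: (ltnP i m) => [im|]; last by exists 0.
  have [_ [x [Z1x Zx]]] := stepZ i im.
  have [[T TE] _ _] := irrZ i (ltnW im).
  apply: contrapT => nog; apply: Zx; apply/TE => g Tg; apply: contrapT => gx.
  apply: nog; exists g => _; split; first by move=> y /TE; apply.
  by move/(_ x Z1x).
(* Substituting [lq] sets the variables of [W] to 0 and renames the others: it restricts polynomials
   to the coordinate subspace, leaving only [#|~: W|] variables. *)
pose lq : N.-tuple {mpoly k[#|~: W|]} :=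
  [tuple \sum_(j < #|~: W|) (enum_val j == i)%:R *: 'X_j | i < N].
have [Q Q0 Qf] := mpoly_algebraic_dependence [tuple f i \mPo lq | i < m] dm.
case/negP: Q0; apply/eqP.
apply: (chain_algebraically_independent irrZ (f := f)) => //.
  by move=> i /stepZ [].
move=> x /ZW Wx; pose y j := x (enum_val (j : 'I_#|~: W|)).
rewrite -[RHS](meval0 y) -Qf !comp_mpoly_meval; apply: meval_eq => i.
rewrite !tnth_mktuple comp_mpoly_meval; apply: meval_eq => j.
rewrite tnth_mktuple raddf_sum /=.
under eq_bigr do rewrite mevalZ mevalXU.
case: (boolP (j \in W)) => [jW|]; last rewrite -in_setC => jW.
  rewrite Wx // big1 // => l _; case: eqP => [lj|]; last by rewrite mul0r.
  by have := enum_valP l; rewrite lj inE jW.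
rewrite (bigD1 (enum_rank_in jW j)) //= big1 => [|l lj].
  by rewrite /y enum_rankK_in // eqxx mul1r addr0.
case: eqP => [e|]; last by rewrite mul0r.
by case/eqP: lj; apply: enum_val_inj; rewrite enum_rankK_in.
Qed.

(** * The variety of the edge ideal: irreducible subsets and tangent spaces *)

Lemma edge_locusP (k : fieldType) n (e : rel 'I_n) (x : 'I_n -> k) :
  zero_locus (@edge_gens k n e) x <-> forall i j, e i j -> x i * x j = 0.
Proof.
split=> [Xx i j eij|Xx _ [i [j [eij ->]]]]; last by rewrite mevalM !mevalXU Xx.
by have := Xx ('X_i * 'X_j); rewrite mevalM !mevalXU; apply; exists i, j.
Qed.

(** Take for [V] the vertices whose coordinate vanishes on all of [Z]; primality puts an endpoint of
    each edge in [V]. *)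
Lemma irreducible_edge_locus (k : fieldType) n (e : rel 'I_n) (Z : ('I_n -> k) -> Prop) :
  irreducible_closed Z -> (forall x, Z x -> zero_locus (@edge_gens k n e) x) ->
  exists V, vertex_cover e V /\ forall x, Z x -> coord_subspace V x.
Proof.
move=> irrZ ZX; exists [set i | `[< vanishing_ideal Z 'X_i >]]; split.
  move=> i j eij; rewrite !inE.
  have : vanishing_ideal Z ('X_i * 'X_j).
    by move=> x /ZX /edge_locusP /(_ _ _ eij); rewrite mevalM !mevalXU.
  by case/(irreducible_closed_prime irrZ) => ?; [left|right]; apply/asboolP.
by move=> x Zx i; rewrite inE => /asboolP /(_ x Zx); rewrite mevalXU.
Qed.

(* The vertices that belong to every vertex cover avoiding the support of [p]. *)
Definition forced (k : fieldType) n (e : rel 'I_n) (p : 'I_n -> k) : {set 'I_n} :=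
  [set i | [exists j, e i j && (p j != 0)]].

Lemma forced_sub_cover (k : fieldType) n (e : rel 'I_n) (p : 'I_n -> k) V :
  vertex_cover e V -> coord_subspace V p -> forced e p \subset V.
Proof.
move=> covV Vp; apply/subsetP => i; rewrite inE => /existsP [j /andP [eij pj]].
by case: (covV i j eij) => // /Vp pj0; rewrite pj0 eqxx in pj.
Qed.

(** If [i] has a neighbour [j] with [p j != 0], then [p i = 0] and the differential of ['X_i * 'X_j]
    at [p] is [p j] times the [i]-th coordinate. If [i] is not forced, the line through [p] in
    direction [i] stays in the variety, so the [i]-th partial derivative of every [f] in the
    vanishing ideal is 0 at [p]; generators of that ideal need not be known. *)
Lemma tangent_spaceP (k : closedFieldType) n (e : rel 'I_n) (p : 'I_n -> k) v :
  simple_graph e -> zero_locus (@edge_gens k n e) p ->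
  tangent_space (zero_locus (@edge_gens k n e)) p v <->
  forall i, i \in forced e p -> v 0 i = 0.
Proof.
move=> [esym eirr] Xp; have Xp' := (edge_locusP e p).1 Xp; split.
  move=> Tv i; rewrite inE => /existsP [j /andP [eij pj]].
  have pi : p i = 0.
    by apply/eqP; have /eqP := Xp' i j eij; rewrite mulf_eq0 (negbTE pj) orbF.
  have ij : i != j by apply: contraNneq (eirr j) => {1}<-.
  have := Tv ('X_i * 'X_j) => /(_ _) H.
  have {H}/eqP :=
    H (fun x Xx => Xx _ (ex_intro _ i (ex_intro _ j (conj eij erefl)))).
  rewrite (bigD1 i) //= big1 => [|l li].
    rewrite addr0 mderivM !mderivX !mnm1E eqxx [j == i]eq_sym (negbTE ij) !scale1r scale0r.
    have -> : (U_(i) - U_(i))%MM = 0%MM :> 'X_{1..n}.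
      by apply/mnmP => l; rewrite mnmBE mnm0E subnn.
    rewrite mpolyX0 mulr0 addr0 mul1r mevalXU mulf_eq0 (negbTE pj) /=.
    by move/eqP.
  rewrite mderivM !mderivX !mnm1E [i == l]eq_sym (negbTE li) scale0r mul0r add0r.
  by rewrite mevalM mevalXU pi !mul0r.
move=> Fv f fX; rewrite big1 // => i _.
case: (boolP (i \in forced e p)) => [/Fv ->|iF]; first by rewrite mulr0.
have nbr0 j : e i j -> p j = 0.
  move=> eij; apply/eqP; apply: contraNT iF => pj.
  by rewrite inE; apply/existsP; exists j; rewrite eij.
have := @directional_derivative_eq0 k n f p (fun j => (j == i)%:R).
rewrite (bigD1 i) //= big1 => [|j /negbTE ->]; last by rewrite mulr0.
rewrite eqxx mulr1 addr0 => -> //; first by rewrite mul0r.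
move=> t; apply: fX; apply/edge_locusP => a b eab.
have [ai|ai] := eqVneq a i.
  have [bi|bi] := eqVneq b i; first by rewrite ai bi (negbTE (eirr i)) in eab.
  by rewrite mulr0 addr0 (nbr0 b) ?mulr0 // -ai.
have [bi|bi] := eqVneq b i; last by rewrite !mulr0 !addr0 Xp'.
by rewrite mulr0 addr0 (nbr0 a) ?mul0r // esym -bi.
Qed.

Definition coord_vectors (k : fieldType) n (S : {set 'I_n}) : #|S|.-tuple 'rV[k]_n :=
  [tuple delta_mx 0 (enum_val j) | j < #|S|].

Lemma free_coord_vectors (k : fieldType) n (S : {set 'I_n}) : free (coord_vectors k S).
Proof.
apply/freeP => c c0 i.
have : (\sum_(j < #|S|) c j *: (coord_vectors k S)`_j) 0 (enum_val i) = 0.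
  by rewrite c0 mxE.
rewrite summxE.
under eq_bigr do
  rewrite -tnth_nth tnth_mktuple !mxE eqxx (inj_eq enum_val_inj) /=.
rewrite (bigD1 i) //= big1 => [|j ji]; first by rewrite eqxx mulr1 addr0.
by rewrite eq_sym (negbTE ji) mulr0.
Qed.

Lemma size_free_coord (k : fieldType) n (S : {set 'I_n}) (vs : seq 'rV[k]_n) :
  free vs -> (forall v, v \in vs -> forall i, i \notin S -> v 0 i = 0) ->
  (size vs <= #|S|)%N.
Proof.
move=> frvs vsS; move: frvs; rewrite /free => /eqP <-.
rewrite -(size_tuple (coord_vectors k S)); apply: leq_trans (dim_span _).
apply: dimvS; apply/span_subvP => v /vsS vS.
rewrite (row_sum_delta v); apply: memv_suml => i _.
case: (boolP (i \in S)) => [iS|/vS ->]; last by rewrite scale0r mem0v.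
apply/memvZ/memv_span/tnthP; exists (enum_rank_in iS i).
by rewrite tnth_mktuple enum_rankK_in.
Qed.

Lemma tangent_dim_forced (k : closedFieldType) n (e : rel 'I_n) (p : 'I_n -> k) :
  simple_graph e -> zero_locus (@edge_gens k n e) p ->
  tangent_dim (zero_locus (@edge_gens k n e)) p #|~: forced e p|.
Proof.
move=> sg Xp; split.
  exists (coord_vectors k (~: forced e p)).
  split; [exact: size_tuple | exact: free_coord_vectors |].
  move=> _ /tnthP [i ->]; rewrite tnth_mktuple.
  have := enum_valP i; rewrite inE => iF.
  apply/tangent_spaceP => // j jF; rewrite mxE eqxx /=.
  by case: eqP => // ji; rewrite -ji jF in iF.
move=> vs frvs Tvs; apply: size_free_coord => // v /Tvs Tv i.
by rewrite inE negbK; move/tangent_spaceP: Tv; apply.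
Qed.

(** * Smooth points and minimal vertex covers *)

Lemma smooth_forced_minimal_cover (k : closedFieldType) n (e : rel 'I_n) (p : 'I_n -> k) :
  simple_graph e -> smooth_point (zero_locus (@edge_gens k n e)) p ->
  minimal_vertex_cover e (forced e p).
Proof.
move=> sg [Xp [d [[[Z [irrZ stepZ]] _] [_ Td]]]].
have [[vs [szvs frvs Tvs]] _] := tangent_dim_forced sg Xp.
have Fd : (#|~: forced e p| <= d)%N by rewrite -szvs; apply: Td.
have [irrZd Zp ZX] := irrZ d (leqnn d).
have [V [covV ZV]] := irreducible_edge_locus irrZd ZX.
have dV : (d <= #|~: V|)%N.
  by apply: coord_subspace_chain_length stepZ ZV => i /irrZ [].
(* [forced e p] lies in [V], and the complement of [V] has at least [d] elements, hence at least as
   many as that of [forced e p]. *)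
have FV : forced e p = V.
  apply/setC_inj/esym/eqP; rewrite eqEcard setCS (leq_trans Fd dV) andbT.
  exact: forced_sub_cover covV (ZV p Zp).
split=> [|W covW WF]; first by rewrite FV.
apply/eqP; rewrite eqEsubset WF; apply: forced_sub_cover => // i iW.
by apply: (ZV p Zp); rewrite -FV (subsetP WF).
Qed.

(** A vertex of [W] with all its neighbours in [W] could be removed from the cover, against
    minimality. *)
Lemma forced_support_cover (k : fieldType) n (e : rel 'I_n) (W : {set 'I_n}) (p : 'I_n -> k) :
  simple_graph e -> minimal_vertex_cover e W -> (forall i, (p i == 0) = (i \in W)) ->
  forced e p = W.
Proof.
move=> [esym eirr] [covW minW] pW.
apply/eqP; rewrite eqEsubset forced_sub_cover //=; last first.
  by move=> i; rewrite -pW => /eqP.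
apply/subsetP => i iW; apply: contraT => iF.
have nbrW j : e i j -> j \in W.
  move=> eij; rewrite -pW; apply: contraNT iF => pj.
  by rewrite inE; apply/existsP; exists j; rewrite eij.
suff covW' : vertex_cover e (W :\ i).
  by rewrite -(minW _ covW' (subsetDl _ _)) !inE eqxx in iW.
move=> a b eab; rewrite !inE.
have [ai|ai] := eqVneq a i.
  right; rewrite nbrW -?ai // andbT; apply: contraTneq eab => ->.
  by rewrite (negbTE (eirr a)).
have [bi|bi] := eqVneq b i; first by left; apply: nbrW; rewrite esym -bi.
by case: (covW a b eab) => ->; [left|right].
Qed.

Lemma smooth_support_cover (k : closedFieldType) n (e : rel 'I_n) (W : {set 'I_n})
    (p : 'I_n -> k) :
  simple_graph e -> minimal_vertex_cover e W -> (forall i, (p i == 0) = (i \in W)) ->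
  smooth_point (zero_locus (@edge_gens k n e)) p.
Proof.
move=> sg mW pW; have FW := forced_support_cover sg mW pW.
have [covW minW] := mW.
have WX x : coord_subspace W x -> zero_locus (@edge_gens k n e) x.
  move=> Wx; apply/edge_locusP => i j /covW [] /Wx ->; first by rewrite mul0r.
  by rewrite mulr0.
have Wp : coord_subspace W p by move=> i; rewrite -pW => /eqP.
split; first exact: WX.
exists #|~: W|; split; last by rewrite -FW; apply: tangent_dim_forced; rewrite ?FW //; exact: WX.
split; last first.
  move=> [Z [irrZ stepZ]].
  have [irrZd Zp ZX] := irrZ _ (leqnn _).
  have [V [covV ZV]] := irreducible_edge_locus irrZd ZX.
  have : (#|~: W|.+1 <= #|~: V|)%N.
    by apply: coord_subspace_chain_length stepZ ZV => i /irrZ [].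
  rewrite ltnNge subset_leq_card // setCS -FW.
  exact: forced_sub_cover covV (ZV p Zp).
(* A flag of affine subspaces through [p]: the [i]-th one frees the first [i] coordinates listed in
   [r]. For [j] in [W], [index j r] is the size of [r], so these coordinates stay fixed at 0
   throughout. *)
pose r := enum (~: W).
exists (fun i x => forall j, (i <= index j r)%N -> x j = p j); split=> i.
  move=> iW; split=> // [|x xp]; last first.
    apply: WX => j jW; rewrite xp ?Wp //; apply: leq_trans iW _.
    by rewrite cardE memNindex // mem_enum inE jW.
  apply: line_stable_irreducible; last 1 first.
  - by move=> x y t Zx Zy j ij; rewrite /line Zx ?Zy // subrr mulr0 addr0.
  - exists (fun f => exists2 j, (i <= index j r)%N & f = 'X_j - (p j)%:MP) => x.
    split=> [Zx _ [j ij ->]|Zx j ij].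
      by rewrite mevalB mevalXU mevalC Zx ?subrr.
    apply/eqP; rewrite -subr_eq0; apply/eqP.
    by have := Zx ('X_j - (p j)%:MP); rewrite mevalB mevalXU mevalC; apply; exists j.
  - by exists p.
rewrite cardE => iW; split=> [x Zx j ij|]; first by apply: Zx; apply: leq_trans ij.
have [i0 _] : exists i0 : 'I_n, true.
  by case: (enum _) iW => // i0; exists i0.
pose c := nth i0 r i; have ic : index c r = i by rewrite index_uniq ?enum_uniq.
(* Coordinate [c] is the one freed between steps [i] and [i.+1]; as [c] is outside [W], [p c] is
   nonzero and resetting it to 0 leaves the [i]-th subspace. *)
exists (fun j => if j == c then 0 else p j); split.
  by move=> j ij; case: eqP => // jc; move: ij; rewrite jc ic ltnn.
move/(_ c); rewrite ic eqxx => /(_ (leqnn _)) /esym /eqP; rewrite pW.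
by apply/negP; have := mem_nth i0 iW; rewrite mem_enum inE.
Qed.

(** * Jets of the edge ideal and the principal component *)

Lemma coef_arc (k : fieldType) n s (A : 'M[k]_(n, s.+1)) i (l : 'I_s.+1) :
  (arc A i)`_l = A i l.
Proof.
rewrite /arc coef_sum (bigD1 l) //= big1 => [|j jl].
  by rewrite coefZ coefXn eqxx mulr1 addr0.
by rewrite coefZ coefXn eq_sym (inj_eq val_inj) (negbTE jl) mulr0.
Qed.

Lemma jet_scheme_edgeP (k : fieldType) n s (e : rel 'I_n) (A : 'M[k]_(n, s.+1)) :
  jet_scheme (@edge_gens k n e) A <->
  forall i j, e i j -> forall l, (l <= s)%N -> (arc A i * arc A j)`_l = 0.
Proof.
have arcM i j : mmap (@polyC k) (arc A) ('X_i * 'X_j) = arc A i * arc A j.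
  by rewrite rmorphM /= !mmapX !mmap1U.
split=> [JA i j eij l ls|JA _ [i [j [eij ->]]] l ls]; last by rewrite arcM JA.
by rewrite -arcM JA //; exists i, j.
Qed.

(** Once the lower coefficients of [a] vanish, the coefficient of degree [l] in [a * b] is the
    [l]-th one of [a] times the nonzero constant term of [b]. *)
Lemma coef_mul_unit_eq0 (k : fieldType) (a b : {poly k}) s :
  b`_0 != 0 -> (forall l, (l <= s)%N -> (a * b)`_l = 0) ->
  forall l, (l <= s)%N -> a`_l = 0.
Proof.
move=> b0 ab l; elim/ltn_ind: l => l IH ls; have := ab l ls.
rewrite coefM big_ord_recr /= subnn big1 => [|j _]; last first.
  by rewrite IH ?mul0r // (leq_trans _ ls) // ltnW.
by rewrite add0r => /eqP; rewrite mulf_eq0 (negbTE b0) orbF => /eqP.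
Qed.

Lemma jet_forced_eq0 (k : fieldType) n s (e : rel 'I_n) (A : 'M[k]_(n, s.+1)) :
  jet_scheme (@edge_gens k n e) A -> jet_cover_locus (forced e (jet_proj A)) A.
Proof.
move=> /jet_scheme_edgeP JA i; rewrite inE => /existsP [j /andP [eij Aj]] l.
rewrite -coef_arc; apply: (coef_mul_unit_eq0 (b := arc A j)) (JA i j eij) _ _.
  by rewrite (coef_arc A j ord0).
by rewrite -ltnS.
Qed.

Lemma jet_cover_locus_scheme (k : fieldType) n s (e : rel 'I_n) W (A : 'M[k]_(n, s.+1)) :
  vertex_cover e W -> jet_cover_locus W A -> jet_scheme (@edge_gens k n e) A.
Proof.
move=> covW WA; have arc0 i : i \in W -> arc A i = 0.
  by move=> iW; rewrite /arc big1 // => l _; rewrite WA // scale0r.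
apply/jet_scheme_edgeP => i j /covW [] /arc0 -> l _.
  by rewrite mul0r coef0.
by rewrite mulr0 coef0.
Qed.

Lemma jet_coords_line (k : fieldType) n s (A B : 'M[k]_(n, s.+1)) t :
  line (jet_coords A) (jet_coords B) t =1 jet_coords (A + t *: (B - A)).
Proof. by move=> i; rewrite /jet_coords linearD linearZ linearB !mxE. Qed.

Theorem mainTheorem6 (k : closedFieldType) (n : nat) (e : rel 'I_n) (s : nat) :
  simple_graph e -> connected_graph e -> (exists i j, e i j) ->
  forall A : 'M[k]_(n, s.+1),
    principal_component e A <->
    exists W : {set 'I_n}, minimal_vertex_cover e W /\ jet_cover_locus W A.
Proof.
move=> sg _ _ A; split=> [PA|[W [mW WA]] f fJ].
  apply: contrapT => noW.
  (* For a minimal cover [W], [h W] is a jet coordinate indexed by a vertex of [W] and nonzero at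
     [A]; other sets receive the default 0. *)
  have /choice [h hP] : forall W : {set 'I_n}, exists h : {mpoly k[n * s.+1]},
      minimal_vertex_cover e W -> h.@[jet_coords A] != 0 /\
      forall B : 'M[k]_(n, s.+1), jet_cover_locus W B -> h.@[jet_coords B] = 0.
    move=> W; apply: contrapT => noh; apply: noW; exists W; split.
      by apply: contrapT => nmW; apply: noh; exists 0 => /nmW.
    move=> i iW l; apply: contrapT => /eqP Ail; apply: noh.
    exists 'X_(mxvec_index i l) => _; split=> [|B WB].
      by rewrite mevalXU /jet_coords mxvecE.
    by rewrite mevalXU /jet_coords mxvecE WB.
  (* Every jet over a smooth point kills the factor of its own forced cover, so [g] vanishes on the
     closure, while no factor vanishes at [A]. *)
  pose g := \prod_(W : {set 'I_n} | `[< minimal_vertex_cover e W >]) h W.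
  have /eqP : g.@[jet_coords A] = 0.
    apply: PA => _ [B [[JB smB] ->]].
    have mF := smooth_forced_minimal_cover sg smB.
    rewrite /g rmorph_prod (bigD1 (forced e (jet_proj B))) /=; last exact/asboolP.
    by rewrite (proj2 (hP _ mF)) ?mul0r //; apply: jet_forced_eq0.
  rewrite rmorph_prod /=; apply/negP/prodf_neq0 => W /asboolP mW.
  by case: (hP W mW).
apply/eqP; apply: contraT => fA.
(* Density in the linear space of [W]: [g] is nonzero at a jet of this space exactly when its base
   point has support the complement of [W], hence is smooth. [B0] is such a jet, so the line from
   [A] to [B0] contains a jet over a smooth point where [f] does not vanish. *)
pose B0 : 'M[k]_(n, s.+1) := \matrix_(i, l) (i \notin W)%:R.
pose g : {mpoly k[n * s.+1]} := \prod_(i | i \notin W) 'X_(mxvec_index i ord0).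
have gE B : g.@[jet_coords B] = \prod_(i | i \notin W) jet_proj B i.
  by rewrite rmorph_prod; apply: eq_bigr => i _; rewrite /= mevalXU /jet_coords mxvecE.
have gB0 : g.@[jet_coords B0] != 0.
  by rewrite gE; apply/prodf_neq0 => i iW; rewrite /jet_proj mxE iW oner_eq0.
have [t] := line_nonzero fA gB0.
rewrite !(meval_eq _ (jet_coords_line A B0 t)); set B := A + _ => -[fB gB].
have WB : jet_cover_locus W B.
  by move=> i iW l; rewrite !mxE iW WA // subrr mulr0 addr0.
case/negP: fB; apply/eqP/fJ; exists B; split=> //.
split; first exact: jet_cover_locus_scheme mW.1 WB.
apply: smooth_support_cover mW _ => // i.
case: (boolP (i \in W)) => iW; first by rewrite /jet_proj WB ?eqxx.
by apply/negbTE; move: gB; rewrite gE => /prodf_neq0; apply.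
Qed.
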